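(* Let $N\ge 1$ be an integer and let $a,b>0$ with $ab<1$. For $\ell\in\mathbb{Z}$ let $t^{[\ell]}$ be the Laurent (trigonometric) polynomial corresponding to the $N$th order B-spline $g=s_N$, $$t^{[\ell]}(x)=\sum_{k=-\lfloor N/a\rfloor}^{\lfloor N/a\rfloor}t^{[\ell]}_k\cos(2\pi kx),\qquad t^{[\ell]}_k=\int_{\mathbb{R}}g\left(y-\tfrac{a}{2}k\right)g\left(y+\tfrac{a}{2}k\right)\cos(2\pi b\ell y)\,dy .$$ Then there exists a constant $C>0$ (independent of $\ell$) such that for every integer $\ell$ with $|\ell|>0$, $$\left|\sup_{x\in[-1/2,1/2]}t^{[\ell]}(x)-\inf_{x\in[-1/2,1/2]}t^{[\ell]}(x)\right|\le C\,|\ell|^{-N}.$$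
   Context: B-splines: $s_1=\chi_{[-1/2,1/2]}$ and $s_N=s_1*s_{N-1}$ for $N\ge 2$. *)

(* Defs.v *)
From mathcomp Require Import all_boot all_order all_algebra.
From mathcomp Require Import all_classical all_reals all_analysis.
Set Implicit Arguments.
Unset Strict Implicit.
Unset Printing Implicit Defensive.
Import Order.TTheory GRing.Theory Num.Theory.
Import numFieldNormedType.Exports.
Local Open Scope classical_set_scope.
Local Open Scope ring_scope.

Definition convolution (R : realType) (f g : R -> R) (x : R) : R :=
  \int[lebesgue_measure]_y (f y * g (x - y)).

Definition box (R : realType) : R -> R := \1_(`[- 2^-1, 2^-1]).

(* Only meaningful for 1 <= N; bspline 0 is the junk value s_1. *)
Definition bspline (R : realType) (N : nat) : R -> R :=
  iter N.-1 (convolution (@box R)) (@box R).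
Arguments bspline R N : clear implicits.

Definition tcoef (R : realType) (g : R -> R) (a b : R) (l k : int) : R :=
  \int[lebesgue_measure]_y
    (g (y - a / 2 * k%:~R) * g (y + a / 2 * k%:~R)
     * cos (2 * pi * b * l%:~R * y)).

Definition tpoly (R : realType) (N : nat) (a b : R) (l : int) (x : R) : R :=
  let m := Num.floor (N%:R / a) in
  \sum_(k \in [set k : int | - m <= k <= m])
    tcoef (bspline R N) a b l k * cos (2 * pi * k%:~R * x).

(* Main.v *)
Require Import Defs.
From mathcomp Require Import all_boot all_order all_algebra.
From mathcomp Require Import all_classical all_reals all_analysis.
From mathcomp Require Import measurable_realfun finmap zify lra ring.
Import Order.TTheory GRing.Theory Num.Theory.
Import numFieldNormedType.Exports.
Local Open Scope classical_set_scope.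
Local Open Scope ring_scope.

(* It suffices to bound every coefficient t_k by (b |l|)^-N.  Let t = 1/(2 b |l|)
   be half the period of the cosine in t_k, and fdiff t h := h(. + t) - h.
   Translating the integral by t flips the sign of the cosine, so applying
   fdiff t to the integrand multiplies the integral by -2; hence
   |t_k| <= 2^-N * L1norm (fdiff t)^N h with h y = s_N (y - c) * s_N (y + c).
   Differences commute with convolution and can be moved onto one box factor, and
   L1norm (fdiff t s_1) <= 2 t; by Young's inequality (fdiff t)^j s_N is bounded by
   (2t)^j in sup norm for j < N and in L1 norm for j <= N.  The discrete Leibniz
   rule then gives L1norm (fdiff t)^N h <= 2^N (2t)^N. *)

(** * Translation invariance of Lebesgue integrals, and the L1 norm *)

Section L1.
Context {R : realType}.
Notation mu := (@lebesgue_measure R).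
Implicit Types (f g : R -> R) (c A B : R).

(* [lebesgue_measure] lives on [measurableTypeR R]; the ascriptions let the
   pushforward lemmas apply. *)
Lemma measurable_translate c : measurable_fun [set: measurableTypeR R]
  ((fun x => x + c) : measurableTypeR R -> measurableTypeR R).
Proof. exact: measurable_funD. Qed.

Lemma measurable_comp_translate f c : measurable_fun [set: R] f ->
  measurable_fun [set: R] (fun x : R => f (x + c)).
Proof. by move=> mf; exact: (measurableT_comp mf (measurable_translate c)). Qed.

(** By uniqueness of Lebesgue measure it is enough to compare the two measures on half-open
    intervals, where translation preserves length. *)
Lemma lebesgue_measure_translate c (A : set R) : measurable A ->
  pushforward mu ((fun x => x + c) : _ -> measurableTypeR R) A = mu A.
Proof.
move=> mA; have mc := measurable_translate c.
pose mc' := isMeasurableFun.Build _ _ _ _ _ mc.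
pose T := MeasurableFun.Pack (MeasurableFun.Class mc').
apply/esym/(@lebesgue_measure_unique _ (pushforward mu T)) => //= _ [[a b]] _ <-.
rewrite /pushforward /= (_ : _ @^-1` _ = `](a - c), (b - c)]%classic); last first.
  by apply/seteqP; split=> x /=; rewrite !in_itv/= ltrBlDr lerBrDr.
rewrite !lebesgue_measure_itv/= !lte_fin ltrD2r; case: ifP => // _.
by rewrite -!EFinB; congr EFin; ring.
Qed.

Lemma ge0_integral_translate c (f : R -> \bar R) :
  measurable_fun [set: R] f -> (forall x, 0 <= f x)%E ->
  (\int[mu]_x f (x + c)%R = \int[mu]_x f x)%E.
Proof.
move=> mf f0; have mc := measurable_translate c.
rewrite -[LHS](ge0_integral_pushforward mc mu measurableT mf (fun y _ => f0 y)).
by apply: eq_measure_integral => A mA _; exact: lebesgue_measure_translate.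
Qed.

Lemma integral_translate c (f : R -> \bar R) : measurable_fun [set: R] f ->
  (\int[mu]_x f (x + c)%R = \int[mu]_x f x)%E.
Proof.
move=> mf; rewrite integralE [RHS]integralE; congr (_ - _)%E.
  rewrite -[RHS](ge0_integral_translate c (f^\+)%E) => [|//|//].
    by apply: eq_integral => x _; rewrite !funeposE.
  exact: measurable_funepos.
rewrite -[RHS](ge0_integral_translate c (f^\-)%E) => [|//|//].
  by apply: eq_integral => x _; rewrite !funenegE.
exact: measurable_funeneg.
Qed.

Lemma Rintegral_translate c f : measurable_fun [set: R] f ->
  \int[mu]_x f (x + c) = \int[mu]_x f x.
Proof.
move=> mf; rewrite /Rintegral (integral_translate c (EFin \o f))//.
exact/measurable_EFinP.
Qed.

Definition L1norm f : \bar R := (\int[mu]_x `|f x|%:E)%E.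

Lemma L1norm_ge0 f : (0 <= L1norm f)%E.
Proof. by apply: integral_ge0 => x _; rewrite lee_fin. Qed.

Lemma fineK_L1norm f : (L1norm f < +oo)%E -> (fine (L1norm f))%:E = L1norm f.
Proof. by move=> f1; rewrite fineK// ge0_fin_numE// L1norm_ge0. Qed.

Lemma L1norm_translate c f : measurable_fun [set: R] f ->
  L1norm (fun x => f (x + c)) = L1norm f.
Proof.
move=> mf; rewrite /L1norm (ge0_integral_translate c (fun x => `|f x|%:E))//.
by apply/measurable_EFinP; exact: measurableT_comp.
Qed.

Lemma le_L1norm f g : measurable_fun [set: R] f -> measurable_fun [set: R] g ->
  (forall x, `|f x| <= `|g x|) -> (L1norm f <= L1norm g)%E.
Proof.
move=> mf mg fg; apply: ge0_le_integral => //.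
- by apply/measurable_EFinP; exact: measurableT_comp.
- by apply/measurable_EFinP; exact: measurableT_comp.
- by move=> x _; rewrite lee_fin.
Qed.

Lemma L1normD f g : measurable_fun [set: R] f -> measurable_fun [set: R] g ->
  (L1norm (f \+ g)%R <= L1norm f + L1norm g)%E.
Proof.
move=> mf mg.
have mf' : measurable_fun [set: R] (fun x => `|f x|%:E).
  by apply/measurable_EFinP; exact: measurableT_comp.
have mg' : measurable_fun [set: R] (fun x => `|g x|%:E).
  by apply/measurable_EFinP; exact: measurableT_comp.
rewrite /L1norm -ge0_integralD//; apply: ge0_le_integral => //.
- by apply/measurable_EFinP; apply: measurableT_comp => //; exact: measurable_funD.
- exact: emeasurable_funD.
- by move=> x _; rewrite -EFinD lee_fin; exact: ler_normD.
Qed.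

Lemma integrable_L1norm f : measurable_fun [set: R] f -> (L1norm f < +oo)%E ->
  mu.-integrable [set: R] (EFin \o f).
Proof. by move=> mf f1; apply/integrableP; split=> //; exact/measurable_EFinP. Qed.

Lemma L1norm_lty f A : (L1norm f <= A%:E)%E -> (L1norm f < +oo)%E.
Proof. by move=> h; apply: (le_lt_trans h); rewrite ltry. Qed.

Lemma le_normr_Rintegral_L1norm f A : measurable_fun [set: R] f ->
  (L1norm f <= A%:E)%E -> `|\int[mu]_x f x| <= A.
Proof.
move=> mf fA; rewrite -lee_fin EFin_normr_Rintegral//; last first.
  exact: (integrable_L1norm _ mf (L1norm_lty _ _ fA)).
apply: le_trans fA; apply: le_abse_integral => //; exact/measurable_EFinP.
Qed.

Lemma L1normZ k f : measurable_fun [set: R] f ->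
  L1norm (fun x => k * f x) = (`|k|%:E * L1norm f)%E.
Proof.
move=> mf; rewrite /L1norm -ge0_integralZl//.
- by apply: eq_integral => x _; rewrite normrM EFinM.
- by apply/measurable_EFinP; exact: measurableT_comp.
Qed.

(** Hölder's inequality for the exponents 1 and infinity, by pointwise comparison with [B * f x]. *)
Lemma L1normM f g A B : measurable_fun [set: R] f -> measurable_fun [set: R] g ->
  (L1norm f <= A%:E)%E -> (forall x, `|g x| <= B) ->
  (L1norm (f \* g)%R <= (A * B)%:E)%E.
Proof.
move=> mf mg fA gB; have B0 : 0 <= B := le_trans (normr_ge0 _) (gB 0).
apply: (@le_trans _ _ (L1norm (fun x => B * f x))).
  apply: le_L1norm => [| |x].
  - exact: measurable_funM.
  - exact: measurable_funM.
  - by rewrite !normrM mulrC ler_wpM2r// (le_trans (gB x))// ler_norm.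
rewrite L1normZ// ger0_norm// mulrC EFinM lee_wpmul2l//.
Qed.

End L1.

(** * Convolution: commutation with differences, and Young's inequality *)

Section Convolution.
Context {R : realType}.
Notation mu := (@lebesgue_measure R).
Implicit Types (f g : R -> R) (t x A B : R).

Definition fdiff t f : R -> R := fun x => f (x + t) - f x.

Lemma measurable_fdiff t f : measurable_fun [set: R] f ->
  measurable_fun [set: R] (fdiff t f).
Proof. by move=> mf; apply: measurable_funB => //; exact: measurable_comp_translate. Qed.

Lemma measurable_iter_fdiff t n f : measurable_fun [set: R] f ->
  measurable_fun [set: R] (iter n (fdiff t) f).
Proof. by move=> mf; elim: n => //= n ih; exact: measurable_fdiff. Qed.

Lemma measurable_comp_reflect g x : measurable_fun [set: R] g ->
  measurable_fun [set: R] (fun y : R => g (x - y)).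
Proof. by move=> mg; apply: measurableT_comp => //; exact: measurable_funB. Qed.

Lemma integrable_convolution f g x B :
  measurable_fun [set: R] f -> (L1norm f < +oo)%E ->
  measurable_fun [set: R] g -> (forall y, `|g y| <= B) ->
  mu.-integrable [set: R] (EFin \o (fun y => f y * g (x - y))).
Proof.
move=> mf f1 mg gB; have mgx := measurable_comp_reflect g x mg.
apply: integrable_L1norm; first exact: measurable_funM.
have f1E : (L1norm f <= (fine (L1norm f))%:E)%E by rewrite fineK_L1norm.
exact: L1norm_lty (L1normM _ _ _ _ mf mgx f1E (fun y => gB (x - y))).
Qed.

Lemma normr_convolution f g x A B :
  measurable_fun [set: R] f -> (L1norm f <= A%:E)%E ->
  measurable_fun [set: R] g -> (forall y, `|g y| <= B) ->
  `|convolution f g x| <= A * B.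
Proof.
move=> mf fA mg gB; have mgx := measurable_comp_reflect g x mg.
apply: le_normr_Rintegral_L1norm; first exact: measurable_funM.
exact: (L1normM _ _ _ _ mf mgx fA (fun y => gB (x - y))).
Qed.

(** The variable [x] occurs only in the factor [g (x - y)], so linearity of the integral suffices;
    [L1norm f < +oo] and the bound on [g] make both integrands integrable. *)
Lemma fdiff_convolutionr t f g B :
  measurable_fun [set: R] f -> (L1norm f < +oo)%E ->
  measurable_fun [set: R] g -> (forall y, `|g y| <= B) ->
  fdiff t (convolution f g) = convolution f (fdiff t g).
Proof.
move=> mf f1 mg gB; apply/funext => x.
rewrite /fdiff /convolution -RintegralB//=.
- by apply: eq_Rintegral => y _; rewrite mulrBr addrAC.
- exact: integrable_convolution gB.
- exact: integrable_convolution gB.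
Qed.

(** The substitution of [y + t] for [y] in the integral at [x + t] turns [f y * g (x + t - y)] into
    [f (y + t) * g (x - y)]. *)
Lemma fdiff_convolutionl t f g B :
  measurable_fun [set: R] f -> (L1norm f < +oo)%E ->
  measurable_fun [set: R] g -> (forall y, `|g y| <= B) ->
  fdiff t (convolution f g) = convolution (fdiff t f) g.
Proof.
move=> mf f1 mg gB; apply/funext => x.
have mft := measurable_comp_translate f t mf.
rewrite {1}/fdiff {1}/convolution.
rewrite -(Rintegral_translate t (fun y => f y * g (x + t - y))); last first.
  by apply: measurable_funM => //; exact: measurable_comp_reflect.
rewrite /convolution -RintegralB//=.
- apply: eq_Rintegral => y _; rewrite /fdiff mulrBl.
  by congr (_ * g _ - _); ring.
- rewrite (_ : _ \o _ = EFin \o (fun y => f (y + t) * g (x - y))).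
    by apply: integrable_convolution gB => //; rewrite L1norm_translate.
  by apply/funext => y /=; congr (_ * g _)%:E; ring.
- exact: integrable_convolution gB.
Qed.

Let kernel_ f g (z : R * R) : R := f z.2 * g (z.1 - z.2).

Let measurable_kernel f g : measurable_fun [set: R] f ->
  measurable_fun [set: R] g -> measurable_fun [set: R * R] (kernel_ f g).
Proof.
move=> mf mg; apply: measurable_funM; apply: measurableT_comp => //.
exact: measurable_funB.
Qed.

(** Tonelli: with [x] integrated first, the inner integral is [|f y|] times the L1 norm of a
    translate of [g]. *)
Let integral_kernel f g : measurable_fun [set: R] f ->
  measurable_fun [set: R] g ->
  (\int[mu]_x \int[mu]_y `|kernel_ f g (x, y)|%:E = L1norm f * L1norm g)%E.
Proof.
move=> mf mg.
have mk := measurable_kernel f g mf mg.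
have mk' : measurable_fun [set: measurableTypeR R * measurableTypeR R]
    (fun z : measurableTypeR R * measurableTypeR R => `|kernel_ f g z|%:E).
  by apply/measurable_EFinP; exact: measurableT_comp.
have k0 (z : measurableTypeR R * measurableTypeR R) : (0 <= `|kernel_ f g z|%:E)%E.
  by rewrite lee_fin.
rewrite [LHS](@fubini_tonelli _ _ _ _ R mu mu _ mk' k0).
rewrite /L1norm -ge0_integralZr//; first last.
- by apply: integral_ge0 => x _; rewrite lee_fin.
- by apply/measurable_EFinP; exact: measurableT_comp.
apply: eq_integral => y _; rewrite -/(L1norm g) -(L1norm_translate (- y) _ mg).
rewrite /L1norm -ge0_integralZl//; last first.
  apply/measurable_EFinP; apply: measurableT_comp => //.
  exact: measurable_comp_translate.
by apply: eq_integral => x _; rewrite /kernel_ /= normrM EFinM.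
Qed.

Let integrable_kernel f g : measurable_fun [set: R] f -> (L1norm f < +oo)%E ->
  measurable_fun [set: R] g -> (L1norm g < +oo)%E ->
  (mu \x mu)%E.-integrable setT (EFin \o kernel_ f g).
Proof.
move=> mf f1 mg g1; apply/integrable12ltyP.
  by apply/measurable_EFinP; exact: measurable_kernel.
rewrite /= integral_kernel// lte_mul_pinfty//.
- exact: L1norm_ge0.
- by rewrite ge0_fin_numE// L1norm_ge0.
Qed.

Lemma measurable_convolution f g :
  measurable_fun [set: R] f -> (L1norm f < +oo)%E ->
  measurable_fun [set: R] g -> (L1norm g < +oo)%E ->
  measurable_fun [set: R] (convolution f g).
Proof.
move=> mf f1 mg g1; have := measurable_fubini_F (integrable_kernel f g mf f1 mg g1).
move=> mF; exact: (measurableT_comp (fine_measurable measurableT) mF).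
Qed.

(** Young's inequality in L1: the absolute value moves inside the inner integral, and the double
    integral of the kernel factors. *)
Lemma L1norm_convolution f g A B :
  measurable_fun [set: R] f -> (L1norm f <= A%:E)%E ->
  measurable_fun [set: R] g -> (L1norm g <= B%:E)%E ->
  (L1norm (convolution f g) <= (A * B)%:E)%E.
Proof.
move=> mf fA mg gB.
have f1 := L1norm_lty _ _ fA; have g1 := L1norm_lty _ _ gB.
have mk := measurable_kernel f g mf mg.
apply: (@le_trans _ _ (L1norm f * L1norm g)%E); last first.
  by rewrite EFinM lee_pmul// L1norm_ge0.
rewrite -integral_kernel//; apply: ge0_le_integral => //.
- apply/measurable_EFinP; apply: measurableT_comp => //.
  exact: measurable_convolution.
- apply: (@measurable_fun_fubini_tonelli_F _ _ _ _ R mu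
    (fun z : measurableTypeR R * measurableTypeR R => `|kernel_ f g z|%:E)).
    by apply/measurable_EFinP; exact: measurableT_comp.
  by move=> z; rewrite lee_fin.
- move=> x _; have mkx : measurable_fun [set: R] (fun y => (kernel_ f g (x, y))%:E).
    apply/measurable_EFinP; apply: measurable_funM => //.
    exact: measurable_comp_reflect.
  (* The real-valued integral is [fine] of the extended one. As [fine] is 0 at the infinities, the
     bound also holds at those [x] where the inner integral is not finite. *)
  have abse_fine (e : \bar R) : (`|fine e|%:E <= `|e|)%E.
    by case: e => [r| |]; rewrite ?leey //= normr0 leey.
  exact: le_trans (abse_fine _) (le_abse_integral mu measurableT mkx).
Qed.

End Convolution.

(** * Iterated differences and their effect on cosine integrals *)

Section Fdiff.
Context {R : realType}.
Notation mu := (@lebesgue_measure R).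
Implicit Types (f g : R -> R) (t x A B : R).

Lemma normr_iter_fdiff t n f B : (forall x, `|f x| <= B) ->
  forall x, `|iter n (fdiff t) f x| <= B *+ 2 ^ n.
Proof.
move=> fB; elim: n => [//|n ih] x /=; rewrite expnS mulnC mulrnA mulr2n.
by rewrite (le_trans (ler_normB _ _))// lerD.
Qed.

Lemma L1norm_fdiff_lty t f : measurable_fun [set: R] f -> (L1norm f < +oo)%E ->
  (L1norm (fdiff t f) < +oo)%E.
Proof.
move=> mf f1.
have mft := measurable_comp_translate f t mf.
have mNf : measurable_fun [set: R] (fun x => -1 * f x) by exact: measurable_funM.
rewrite (_ : fdiff t f = (fun x => f (x + t)) \+ (fun x => -1 * f x)); last first.
  by apply/funext => x; rewrite /fdiff/= mulN1r.
apply: le_lt_trans (L1normD _ _ mft mNf) _.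
by rewrite L1norm_translate// L1normZ// normrN1 mul1e lte_add_pinfty.
Qed.

Lemma L1norm_iter_fdiff_lty t n f : measurable_fun [set: R] f ->
  (L1norm f < +oo)%E -> (L1norm (iter n (fdiff t) f) < +oo)%E.
Proof.
move=> mf f1; elim: n => //= n ih.
by apply: L1norm_fdiff_lty => //; exact: measurable_iter_fdiff.
Qed.

Lemma iter_fdiff_convolution t n f g B :
  measurable_fun [set: R] f -> (L1norm f < +oo)%E ->
  measurable_fun [set: R] g -> (forall y, `|g y| <= B) ->
  iter n (fdiff t) (convolution f g) = convolution f (iter n (fdiff t) g).
Proof.
move=> mf f1 mg gB; elim: n => //= n ->.
apply: fdiff_convolutionr => //; first exact: measurable_iter_fdiff.
exact: normr_iter_fdiff gB.
Qed.

Lemma iter_fdiffD t n f g :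
  iter n (fdiff t) (f \+ g) = iter n (fdiff t) f \+ iter n (fdiff t) g.
Proof.
elim: n => //= n ->; apply/funext => x; rewrite /fdiff /=; ring.
Qed.

(** Discrete Leibniz rule; unlike for derivatives, one term carries a translate of [g]. *)
Lemma fdiffM t f g :
  fdiff t (f \* g) = (fdiff t f \* (fun x => g (x + t))) \+ (f \* fdiff t g).
Proof. by apply/funext => x; rewrite /fdiff/=; ring. Qed.

(** The argument moves by pi, down or up according to the sign of [w]. *)
Lemma cos_antiperiod (w t y : R) : `|w| * t = pi -> cos (w * (y - t)) = - cos (w * y).
Proof.
have [w0|w0] := ler0P w; rewrite ?mulNr => wt; rewrite mulrBr.
  by rewrite wt cosDpi.
by rewrite wt -[in RHS](subrK pi (w * y)) cosDpi opprK.
Qed.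

Lemma measurable_funM_cos (w : R) f : measurable_fun [set: R] f ->
  measurable_fun [set: R] (fun y => f y * cos (w * y)).
Proof.
move=> mf; apply: measurable_funM => //.
apply: (@measurableT_comp _ _ _ _ _ _ (@cos R) _ ( *%R w)) => //.
by apply: continuous_measurable_fun; exact: continuous_cos.
Qed.

Lemma L1normM_cos (w : R) f A : measurable_fun [set: R] f ->
  (L1norm f <= A%:E)%E -> (L1norm (fun y => f y * cos (w * y))%R <= A%:E)%E.
Proof.
move=> mf; apply: le_trans; apply: le_L1norm => //.
  exact: measurable_funM_cos.
by move=> x; rewrite normrM ler_piMr// ler_norml cos_geN1 cos_le1.
Qed.

Lemma integrableM_cos (w : R) f : measurable_fun [set: R] f ->
  (L1norm f < +oo)%E -> mu.-integrable [set: R] (EFin \o (fun y => f y * cos (w * y))).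
Proof.
move=> mf f1; apply: integrable_L1norm; first exact: measurable_funM_cos.
have f1E : (L1norm f <= (fine (L1norm f))%:E)%E by rewrite fineK_L1norm.
exact: L1norm_lty (L1normM_cos w _ _ mf f1E).
Qed.

(** Translation by [t] passes the shift from [f] to the cosine, which changes sign; the two terms of
    the difference then contribute -1 each. *)
Lemma Rintegral_fdiff_cos (w t : R) f : `|w| * t = pi ->
  measurable_fun [set: R] f -> (L1norm f < +oo)%E ->
  \int[mu]_y (fdiff t f y * cos (w * y)) = -2 * \int[mu]_y (f y * cos (w * y)).
Proof.
move=> wt mf f1; have mft := measurable_comp_translate f t mf.
have -> : \int[mu]_y (fdiff t f y * cos (w * y)) =
    \int[mu]_y (f (y + t) * cos (w * y)) - \int[mu]_y (f y * cos (w * y)).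
  rewrite -RintegralB//.
  - by apply: eq_Rintegral => y _; rewrite /fdiff mulrBl.
  - by apply: integrableM_cos => //; rewrite L1norm_translate.
  - exact: integrableM_cos.
have -> : \int[mu]_y (f (y + t) * cos (w * y)) = -1 * \int[mu]_y (f y * cos (w * y)).
  rewrite -RintegralZl//; last exact: integrableM_cos.
  rewrite -(Rintegral_translate t (fun y => -1 * (f y * cos (w * y)))); last first.
    by apply: measurable_funM => //; exact: measurable_funM_cos.
  apply: eq_Rintegral => y _.
  by rewrite -[in LHS](addrK t y) cos_antiperiod// addrK; ring.
ring.
Qed.

Lemma Rintegral_iter_fdiff_cos (w t : R) n f : `|w| * t = pi ->
  measurable_fun [set: R] f -> (L1norm f < +oo)%E ->
  \int[mu]_y (iter n (fdiff t) f y * cos (w * y)) =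
  (-2) ^+ n * \int[mu]_y (f y * cos (w * y)).
Proof.
move=> wt mf f1; elim: n => [|n ih] /=; first by rewrite expr0 mul1r.
rewrite Rintegral_fdiff_cos//.
- by rewrite ih exprS mulrA.
- exact: measurable_iter_fdiff.
- exact: L1norm_iter_fdiff_lty.
Qed.

(* Each difference with step half a period doubles the cosine coefficient. *)
Lemma normr_cos_coef_le (w t A : R) n f : `|w| * t = pi ->
  measurable_fun [set: R] f -> (L1norm f < +oo)%E ->
  (L1norm (iter n (fdiff t) f) <= (2 ^+ n * A)%:E)%E ->
  `|\int[mu]_y (f y * cos (w * y))| <= A.
Proof.
move=> wt mf f1 fA.
have mnf := measurable_iter_fdiff t n f mf.
have := le_normr_Rintegral_L1norm _ _ (measurable_funM_cos w _ mnf)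
  (L1normM_cos w _ _ mnf fA).
rewrite Rintegral_iter_fdiff_cos// normrM normrX normrN normr_nat.
by rewrite ler_pM2l// exprn_gt0.
Qed.

End Fdiff.

(** * Difference bounds for B-splines and decay of the coefficients *)

Section Bspline.
Context {R : realType}.
Notation mu := (@lebesgue_measure R).
Implicit Types (f g : R -> R) (t x A B : R).

Lemma measurable_indic_itv (i : interval R) :
  measurable_fun [set: R] (\1_[set` i] : R -> R).
Proof. exact: measurable_indic. Qed.

Lemma L1norm_indic_itvcc a b : a <= b -> L1norm (\1_(`[a, b]) : R -> R) = (b - a)%:E.
Proof.
move=> ab; rewrite /L1norm.
under eq_integral do rewrite ger0_norm//.
rewrite integral_indic// setIT.
rewrite [LHS](lebesgue_measure_itv `[a, b]%R)/= lte_fin.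
case: ltP => [_|ba]; first by rewrite EFinB.
by rewrite (_ : b = a) ?subrr//; apply/eqP; rewrite eq_le ba.
Qed.

Lemma normr_box_le1 x : `|@box R x| <= 1.
Proof. by rewrite /box indicE; case: (_ \in _); rewrite ?normr1 ?normr0. Qed.

Lemma measurable_box : measurable_fun [set: R] (@box R).
Proof. exact: measurable_indic_itv. Qed.

Lemma L1norm_box : L1norm (@box R) = 1%E.
Proof.
rewrite /box L1norm_indic_itvcc; last lra.
by congr EFin; lra.
Qed.

(** The difference is nonzero only if exactly one of [x] and [x + t] lies in the box. Then the step
    from [x] to [x + t] enters at the left endpoint or leaves at the right one, and each event
    confines [x] to an interval of length [t]. *)
Lemma normr_fdiff_box_le t x : 0 <= t ->
  `|fdiff t (@box R) x| <=
  \1_(`[- 2^-1 - t, - 2^-1]) x + \1_(`[2^-1 - t, 2^-1]) x.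
Proof.
move=> t0; rewrite /fdiff /box !indicE !mem_setE !in_itv /=.
case: (leP (- 2^-1 - t) x) => ?; case: (leP (- 2^-1) (x + t)) => ? /=; try lra.
all: case: (leP (2^-1 - t) x) => ?; case: (leP (x + t) 2^-1) => ? /=; try lra.
all: case: (leP (- 2^-1) x) => ?; case: (leP x (- 2^-1)) => ? /=; try lra.
all: case: (leP x 2^-1) => ? /=; rewrite ?subrr ?subr0 ?sub0r ?normrN1 ?normr0 ?normr1.
all: lra.
Qed.

Lemma L1norm_fdiff_box t : 0 <= t -> (L1norm (fdiff t (@box R)) <= (2 * t)%:E)%E.
Proof.
move=> t0; have mI := measurable_indic_itv.
apply: (@le_trans _ _ (L1norm ((\1_(`[- 2^-1 - t, - 2^-1]) : R -> R) \+
    (\1_(`[2^-1 - t, 2^-1]) : R -> R)))).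
  apply: le_L1norm => [| |x].
  - by apply: measurable_fdiff; exact: measurable_box.
  - exact: measurable_funD.
  - by apply: (le_trans (normr_fdiff_box_le t x t0)); exact: ler_norm.
apply: le_trans (L1normD _ _ (mI _) (mI _)) _.
rewrite !L1norm_indic_itvcc ?gerBl// -EFinD lee_fin; lra.
Qed.

(** Induction on [n]: one difference goes to the new box factor and costs [2 * t] in L1, the others
    stay on the previous spline. The sup bound stops one order before the L1 bound because the box
    jumps, so its difference is small in L1 only. *)
Lemma bspline_fdiff_bounds t n : 0 <= t ->
  [/\ measurable_fun [set: R] (bspline R n.+1),
      forall j x, (j <= n)%N -> `|iter j (fdiff t) (bspline R n.+1) x| <= (2 * t) ^+ j &
      forall j, (j <= n.+1)%N ->
        (L1norm (iter j (fdiff t) (bspline R n.+1)) <= ((2 * t) ^+ j)%:E)%E].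
Proof.
move=> t0; elim: n => [|n [ms sn L1n]].
  split => [|[|//] x _|[_|[_|//]]].
  - exact: measurable_box.
  - by rewrite expr0; exact: normr_box_le1.
  - by rewrite expr0 /= [bspline _ _]/(@box R) L1norm_box.
  - by rewrite expr1; exact: L1norm_fdiff_box.
have -> : bspline R n.+2 = convolution (@box R) (bspline R n.+1) by [].
have mb := measurable_box.
have b1 : (L1norm (@box R) <= 1%:E)%E by rewrite L1norm_box.
have b1y := L1norm_lty _ _ b1.
have db := L1norm_fdiff_box t t0.
have s1 x : `|bspline R n.+1 x| <= 1 by have := sn 0%N x (leq0n _); rewrite expr0.
have L1s : (L1norm (bspline R n.+1) <= 1%:E)%E.
  by have := L1n 0%N (leq0n _); rewrite expr0.
have L1sy := L1norm_lty _ _ L1s.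
have mi j := measurable_iter_fdiff t j _ ms.
(* The first [j] differences move to the spline, the last one to the box. *)
have convS j : iter j.+1 (fdiff t) (convolution (@box R) (bspline R n.+1)) =
    convolution (fdiff t (@box R)) (iter j (fdiff t) (bspline R n.+1)).
  rewrite /= (iter_fdiff_convolution _ _ _ _ 1)//.
  by apply: fdiff_convolutionl => //; exact: normr_iter_fdiff s1.
have mdb := measurable_fdiff t _ mb.
split => [|[|j] x jn|[|j] jn].
- exact: measurable_convolution.
- by rewrite expr0 -(mulr1 1); apply: normr_convolution.
- by rewrite convS exprS; apply: normr_convolution => // y; exact: sn.
- by rewrite expr0 -(mulr1 1); apply: L1norm_convolution.
- by rewrite convS exprS; apply: L1norm_convolution => //; exact: L1n.
Qed.

(** Induction on [m]: the Leibniz rule trades one outer difference for two terms, raising [i] in one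
    and [j] in the other, so [m + i + j] is preserved and the number of terms doubles. Arbitrary
    shifts [c] and [d] absorb the translates that the rule creates. *)
Lemma L1norm_iter_fdiffM_translate t D N f g m i j c d :
  measurable_fun [set: R] f -> measurable_fun [set: R] g ->
  (forall j x, (j < N)%N -> `|iter j (fdiff t) f x| <= D ^+ j) ->
  (forall j, (j <= N)%N -> (L1norm (iter j (fdiff t) f) <= (D ^+ j)%:E)%E) ->
  (forall j x, (j < N)%N -> `|iter j (fdiff t) g x| <= D ^+ j) ->
  (forall j, (j <= N)%N -> (L1norm (iter j (fdiff t) g) <= (D ^+ j)%:E)%E) ->
  (0 < N)%N -> (m + i + j = N)%N ->
  (L1norm (iter m (fdiff t) ((fun x => iter i (fdiff t) f (x + c)) \*
     (fun x => iter j (fdiff t) g (x + d)))%R) <= (2 ^+ m * D ^+ N)%:E)%E.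
Proof.
move=> mf mg f_sup f_L1 g_sup g_L1 N0.
elim: m i j c d => [|m ih] i j c d mijN.
  have mfi := measurable_comp_translate _ c (measurable_iter_fdiff t i _ mf).
  have mgj := measurable_comp_translate _ d (measurable_iter_fdiff t j _ mg).
  rewrite expr0 mul1r /= -mijN add0n exprD.
  (* Sup bounds exist only below order [N]: the second factor is bounded in sup if [j < N];
     otherwise [j = N] and [i = 0], and the factors exchange roles. *)
  have [jN|Nj] := ltnP j N.
    apply: L1normM => // [|x]; last exact: g_sup.
    rewrite L1norm_translate; last exact: measurable_iter_fdiff.
    by apply: f_L1; rewrite -mijN add0n leq_addr.
  have i0 : i = 0%N by lia.
  rewrite (_ : _ \* _ = (fun x => iter j (fdiff t) g (x + d)) \*
    (fun x => iter i (fdiff t) f (x + c))); last first.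
    by apply/funext => x /=; rewrite mulrC.
  rewrite mulrC; apply: L1normM => // [|x]; last by apply: f_sup; rewrite i0.
  rewrite L1norm_translate; last exact: measurable_iter_fdiff.
  by apply: g_L1; lia.
rewrite iterSr fdiffM iter_fdiffD.
have -> : fdiff t (fun x => iter i (fdiff t) f (x + c)) =
    (fun x => iter i.+1 (fdiff t) f (x + c)).
  by apply/funext => x; rewrite /fdiff/= addrAC.
have -> : fdiff t (fun x => iter j (fdiff t) g (x + d)) =
    (fun x => iter j.+1 (fdiff t) g (x + d)).
  by apply/funext => x; rewrite /fdiff/= addrAC.
have -> : (fun x => (fun y => iter j (fdiff t) g (y + d)) (x + t)) =
    (fun x => iter j (fdiff t) g (x + (t + d))).
  by apply/funext => x /=; rewrite addrA.
have mF k e h : measurable_fun [set: R] h ->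
  measurable_fun [set: R] (fun x => iter k (fdiff t) h (x + e)).
  by move=> mh; apply: measurable_comp_translate; exact: measurable_iter_fdiff.
apply: le_trans (L1normD _ _ _ _) _.
- by apply: measurable_iter_fdiff; apply: measurable_funM; exact: mF.
- by apply: measurable_iter_fdiff; apply: measurable_funM; exact: mF.
rewrite exprS -mulrA mulr_natl mulr2n EFinD.
apply: leeD; apply: ih; lia.
Qed.

Lemma normr_tcoef_bspline_le (a b : R) (n : nat) (l k : int) : 0 < b -> l != 0 ->
  `|tcoef (bspline R n.+1) a b l k| <= (b * `|l|%:~R) ^- n.+1.
Proof.
move=> b0 l0.
have lR : 0 < `|l|%:~R :> R by rewrite ltr0z normr_gt0.
pose t : R := (2 * (b * `|l|%:~R))^-1.
have t0 : 0 <= t by rewrite invr_ge0 !mulr_ge0// ltW.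
have [ms ssup sL1] := bspline_fdiff_bounds t n t0.
(* With this [t], [2 * t] is the inverse of [b * |l|], so the target is the power that the
   difference bounds produce. *)
have tE : (b * `|l|%:~R) ^- n.+1 = (2 * t) ^+ n.+1.
  by rewrite -exprVn; congr (_ ^+ _); rewrite /t [in RHS]invfM mulVKf.
rewrite tE; set c := a / 2 * k%:~R.
pose h (x : R) := bspline R n.+1 (x - c) * bspline R n.+1 (x + c).
have mh : measurable_fun [set: R] h.
  by apply: measurable_funM; exact: measurable_comp_translate.
apply: (@normr_cos_coef_le _ (2 * pi * b * l%:~R) t _ n.+1 h) => //.
- rewrite !normrM -intr_norm (ger0_norm (pi_ge0 R)) (gtr0_norm b0) normr_nat /t.
  by field; rewrite !gt_eqF.
- apply: (@L1norm_lty _ _ (1 * 1)); apply: L1normM.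
  + exact: measurable_comp_translate.
  + exact: measurable_comp_translate.
  + by rewrite L1norm_translate//; exact: (sL1 0%N).
  + by move=> x; exact: (ssup 0%N).
(* All [n.+1] differences are still outside the product, hence [i = j = 0]; the factor [2 ^+ n.+1]
   is the one that [normr_cos_coef_le] cancels. *)
- have := (L1norm_iter_fdiffM_translate t (2 * t) n.+1 _ _ n.+1 0 0 (- c) c ms ms
    ssup sL1 ssup sL1 (ltn0Sn n)).
  by rewrite !addn0; apply.
Qed.

End Bspline.

(** * Oscillation of the polynomial from its coefficient bounds *)

Lemma finite_int_interval (m n : int) : finite_set [set k : int | m <= k <= n].
Proof.
apply: (@sub_finite_set _ _ ((fun i : nat => m + i%:Z) @` `I_(`|n - m|%N.+1))).
  by move=> k /= /andP[mk kn]; exists `|k - m|%N => /=; lia.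
exact/finite_image/finite_II.
Qed.

(** Both extrema lie in [[-B, B]], and a point of [T] between them shows that the difference is
    nonnegative. *)
Lemma osc_le {R : realType} (T : set R) (B : R) : T !=set0 ->
  (forall y, T y -> `|y| <= B) -> `|sup T - inf T| <= 2 * B.
Proof.
move=> T0 TB.
have TB' y : T y -> - B <= y <= B by move=> /TB; rewrite ler_norml.
have sB : sup T <= B by apply: ge_sup => // y /TB' /andP[].
have Bi : - B <= inf T by apply: lb_le_inf => // y /TB' /andP[].
have iS : inf T <= sup T.
  have [y Ty] := T0; apply: (@le_trans _ _ y).
    by apply: ge_inf => //; exists (- B) => z /TB' /andP[].
  by apply: ub_le_sup => //; exists B => z /TB' /andP[].
by rewrite ger0_norm ?subr_ge0//; lra.
Qed.

Theorem lemma4p5 (R : realType) (N : nat) (a b : R)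
    (hN : (1 <= N)%N) (ha : 0 < a) (hb : 0 < b) (hab : a * b < 1) :
  exists C : R, 0 < C /\
    forall l : int, 0 < `|l| ->
      `| sup [set tpoly N a b l x | x in `[- 2^-1, 2^-1]]
         - inf [set tpoly N a b l x | x in `[- 2^-1, 2^-1]] |
      <= C * `|l|%:~R ^- N.
Proof.
case: N hN => // n _.
set m := Num.floor (n.+1%:R / a).
pose D : seq int := fset_set [set k : int | - m <= k <= m].
pose K : R := (size D)%:R.
(* [K] counts the frequencies, 2 comes from [osc_le], and [b ^- n.+1] from the coefficient bound;
   [K + 1] makes positivity immediate. *)
exists (2 * (K + 1) * b ^- n.+1); split.
  by rewrite !mulr_gt0 ?invr_gt0 ?exprn_gt0// ltr_wpDl// ler0n.
move=> l; rewrite normr_gt0 => l0.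
have lR : 0 < `|l|%:~R :> R by rewrite ltr0z normr_gt0.
have tB y : [set tpoly n.+1 a b l x | x in `[- 2^-1, 2^-1]] y ->
    `|y| <= K * (b * `|l|%:~R) ^- n.+1.
  move=> [x _ <-]; rewrite /tpoly -/m fsbig_finite; last exact: finite_int_interval.
  rewrite -/D; apply: le_trans (ler_norm_sum _ _ _) _.
  (* The coefficient bound is uniform in [k] and the cosines are at most 1 in absolute value, so the
     sum is at most [K] equal terms. *)
  apply: (@le_trans _ _ (\sum_(k <- D) (b * `|l|%:~R) ^- n.+1)).
    apply: ler_sum => k _; rewrite normrM.
    apply: le_trans (normr_tcoef_bspline_le a b n l k hb l0).
    by rewrite ler_piMr// ler_norml cos_geN1 cos_le1.
  by rewrite big_const_seq count_predT iter_addr addr0 mulr_natl.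
apply: le_trans (osc_le _ _ _ tB) _.
  by exists (tpoly n.+1 a b l 0), 0 => //=; rewrite in_itv/=; lra.
rewrite exprMn invfM -!mulrA ler_pM2l// ler_wpM2r ?lerDl//.
by rewrite mulr_ge0// invr_ge0 exprn_ge0// ltW.
Qed.
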